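(* Let $\ell\ge 7$ be odd. There is an $\ell$-cycle decomposition of $K_{2\ell+1}$ together with a $2$-colouring of $V(K_{2\ell+1})$ which is equitable for this decomposition and whose two colour classes have sizes $\ell$ and $\ell+1$.
   Context: An $\ell$-cycle decomposition of a graph is a set of $\ell$-cycles whose edge sets partition the edge set of the graph. A $2$-colouring of the vertices is equitable for the decomposition if every cycle contains either $\lfloor \ell/2\rfloor$ or $\lceil \ell/2\rceil$ vertices of each colour. *)

(* Defs.v *)
From mathcomp Require Import all_boot.
Set Implicit Arguments.
Unset Strict Implicit.
Unset Printing Implicit Defensive.

Record sgraph := SGraph {
  vertex :> finType;
  adj : rel vertex;
  adj_sym : symmetric adj;
  adj_irrefl : irreflexive adj
}.

Section Cycles.
Variable G : sgraph.

Definition edge_set : {set {set G}} :=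
  [set [set p.1; p.2] | p : G * G & adj p.1 p.2].

Definition cycle_edges (s : seq G) : {set {set G}} :=
  [set [set x; next s x] | x in s].

(* A cycle is identified with its edge set, which determines it as a subgraph
   since it has no isolated vertex; its vertex set is then [cover C]. *)
Definition is_cycle (l : nat) (C : {set {set G}}) : Prop :=
  2 < l /\
  exists s : seq G, [/\ size s = l, ucycle (@adj G) s & C = cycle_edges s].

Definition cycle_decomposition (l : nat) (D : {set {set {set G}}}) : Prop :=
  {in D, forall C, is_cycle l C} /\ partition D edge_set.

Definition colour_class (c : G -> bool) (b : bool) : {set G} :=
  [set v | c v == b].

Definition equitable (l : nat) (D : {set {set {set G}}}) (c : G -> bool) :
    Prop :=
  forall C, C \in D -> forall b : bool,
    #|cover C :&: colour_class c b| = l./2 \/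
    #|cover C :&: colour_class c b| = uphalf l.

End Cycles.

Section CompleteGraph.
Variable n : nat.

Definition complete_adj : rel 'I_n := fun x y => x != y.

Lemma complete_adj_sym : symmetric complete_adj.
Proof. by move=> x y; rewrite /complete_adj /= eq_sym. Qed.

Lemma complete_adj_irrefl : irreflexive complete_adj.
Proof. by move=> x; rewrite /complete_adj /= eqxx. Qed.

Definition complete_graph : sgraph :=
  SGraph complete_adj_sym complete_adj_irrefl.

End CompleteGraph.

(* Main.v *)
Require Import Defs.
From mathcomp Require Import all_boot.
From mathcomp Require Import zify.
Set Implicit Arguments.
Unset Strict Implicit.
Unset Printing Implicit Defensive.

(* Identify the vertices with the residues mod n = 2l+1 and develop one base
   cycle under all n translations.  This is a decomposition as soon as the l
   edges of the base cycle have pairwise distinct circular lengths, hence one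
   edge of each length 1, ..., l.  Colour a residue in 0, ..., 2l by its parity.
   If the vertices of the base cycle, in increasing order, alternate in parity
   starting from an even one, then after a translation they still do, except
   that the parity flips for those that wrapped around (n is odd); as l is odd,
   the two colours still occur floor(l/2) and ceil(l/2) times. *)

(** * Cycles enumerated by a function on indices *)

Lemma next_mkseq (T : eqType) (f : nat -> T) l i :
  uniq (mkseq f l) -> i < l -> next (mkseq f l) (f i) = f (i.+1 %% l).
Proof.
move=> uf il; rewrite -{1}(nth_mkseq (f 0) f il) next_nth mem_nth ?size_mkseq //.
rewrite index_uniq ?size_mkseq //; case: l il uf => // l il uf.
rewrite /mkseq [iota 0 _]/= map_cons -/(mkseq _ _).
have [il'|li] := ltnP i l; first by rewrite (nth_map 0) ?size_iota // nth_iota // modn_small.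
have ->: i = l by lia.
by rewrite modnn nth_default // size_map size_iota.
Qed.

Lemma cycle_edges_mkseq (G : sgraph) (f : nat -> G) l :
    uniq (mkseq f l) ->
  cycle_edges (mkseq f l) = [set [set f i; f (i.+1 %% l)] | i : 'I_l].
Proof.
move=> uf; apply/setP=> E; apply/imsetP/imsetP=> [[x /mapP[i]]|[i _ ->]].
  rewrite mem_iota => /= il -> ->; exists (Ordinal il) => //=.
  by rewrite next_mkseq.
exists (f i); last by rewrite next_mkseq.
by apply: map_f; rewrite mem_iota /=.
Qed.

(** * Parity counts *)

Lemma count_odd_iota m k b :
  count (fun j => odd j == b) (iota m k) =
  if odd m == b then uphalf k else k./2.
Proof.
elim: k m b => [|k IHk] m b; first by case: ifP.
rewrite -[k.+1]/(1 + k) iotaD count_cat IHk /= addn0 addn1 /=.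
by case: (odd m); case: b; rewrite ?uphalf_half /=; lia.
Qed.

(* The parities of the increasing vertices of a translate of the base cycle:
   alternating, with a flip from the first vertex J that wraps around. *)
Lemma count_odd_shifted l J b : odd l -> J <= l ->
  let N := count (fun j => odd (if j < J then j else j.+1) == b) (iota 0 l) in
  N = l./2 \/ N = uphalf l.
Proof.
move=> ol Jl; have := iotaD 0 J (l - J); rewrite subnKC // add0n => -> /=.
rewrite count_cat.
rewrite (@eq_in_count _ _ (fun j => odd j == b) (iota 0 J)); last first.
  by move=> j; rewrite mem_iota => /andP[_ jJ]; rewrite jJ.
rewrite (@eq_in_count _ _ (fun j => odd j == ~~ b) (iota J _)); last first.
  move=> j; rewrite mem_iota => /andP[Jj _]; rewrite ltnNge Jj /=.
  by case: (odd j); case: b.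
rewrite !count_odd_iota; case: b; case oJ : (odd J) => /=; lia.
Qed.

(** * Circular length and translation modulo n *)

Definition circ_dist (n x y : nat) : nat :=
  minn (maxn x y - minn x y) (n - (maxn x y - minn x y)).

Lemma modnD_lt n a b : a < n -> b < n ->
  (a + b) %% n = if a + b < n then a + b else a + b - n.
Proof.
move=> an bn; case: ltnP => abn; first by rewrite modn_small.
by rewrite -{1}(subnK abn) modnDr modn_small //; lia.
Qed.

Lemma circ_dist_shift n x y t : x < n -> y < n -> t < n ->
  circ_dist n ((x + t) %% n) ((y + t) %% n) = circ_dist n x y.
Proof.
move=> xn yn tn; rewrite !modnD_lt // /circ_dist.
by do !case: ifPn => ?; lia.
Qed.

Lemma eq_circ_dist n x y t x' y' t' :
    x < n -> y < n -> t < n -> x' < n -> y' < n -> t' < n ->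
    (x + t) %% n = (x' + t') %% n -> (y + t) %% n = (y' + t') %% n ->
  circ_dist n x y = circ_dist n x' y'.
Proof.
move=> xn yn tn xn' yn' tn' e1 e2.
by rewrite -(circ_dist_shift xn yn tn) e1 e2 circ_dist_shift.
Qed.

Lemma shift_inj n x t t' : x < n -> t < n -> t' < n ->
  (x + t) %% n = (x + t') %% n -> t = t'.
Proof.
by move=> xn tn tn'; rewrite !modnD_lt //; do !case: ifPn => ?; lia.
Qed.

(** Adding the two congruences gives 2t = 2t' mod n, so t = t' because n is odd, and then x = y.
    This rules out that two translates of one edge coincide with their ends exchanged. *)
Lemma shift_swap n x y t t' : odd n -> x < n -> y < n -> t < n -> t' < n ->
  (x + t) %% n = (y + t') %% n -> (y + t) %% n = (x + t') %% n -> x = y.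
Proof.
move=> on xn yn tn tn'; rewrite !modnD_lt //.
case: (ltnP (x + t) n); case: (ltnP (y + t') n); case: (ltnP (y + t) n);
case: (ltnP (x + t') n); lia.
Qed.

Lemma circ_distC n x y : circ_dist n x y = circ_dist n y x.
Proof. by rewrite /circ_dist [maxn x y]maxnC [minn x y]minnC. Qed.

Lemma eq_set2 (T : finType) (a b c d : T) :
  [set a; b] = [set c; d] -> (a = c /\ b = d) \/ (a = d /\ b = c).
Proof.
move=> e; have /set2P aP : a \in [set c; d] by rewrite -e set21.
have /set2P bP : b \in [set c; d] by rewrite -e set22.
have /set2P cP : c \in [set a; b] by rewrite e set21.
have /set2P dP : d \in [set a; b] by rewrite e set22.
case: aP bP cP dP => -> [] -> [] cd [] dc; auto.
Qed.

(* v lists the base cycle in cyclic order, u its vertices in increasing order. *)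
Lemma cyclic_decomposition (l : nat) (v u : nat -> nat) :
    odd l -> 2 < l ->
    let n := 2 * l + 1 in
    (forall i, i < l -> v i < n) ->
    {in gtn l &, injective v} ->
    {in gtn l &, injective (fun i => circ_dist n (v i) (v (i.+1 %% l)))} ->
    (forall i, i < l -> exists2 j, j < l & v i = u j) ->
    (forall j, j < l -> u j < n) ->
    (forall i j, i < j < l -> u i < u j) ->
    (forall j, j < l -> odd (u j) = odd j) ->
  exists (D : {set {set {set complete_graph n}}}) (c : complete_graph n -> bool),
    [/\ cycle_decomposition l D,
        equitable l D c
      & exists b : bool,
          #|colour_class c b| = l /\ #|colour_class c (~~ b)| = l + 1].
Proof.
move=> ol l3 n vn vinj dinj vu un umono uodd.
have n0 : 0 < n by rewrite /n; lia.
have on : odd n by rewrite /n; lia.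
pose w m : complete_graph n := Ordinal (ltn_pmod m n0).
have wE a b : w a = w b -> a %% n = b %% n by case.
have l0 : 0 < l by lia.
have vn' i : v (i.+1 %% l) < n by apply: vn; rewrite ltn_pmod.
pose f (t : 'I_n) i := w (v i + t).
have finj (t : 'I_n) : {in gtn l &, injective (f t)}.
  move=> i j il jl /wE; rewrite ![_ + t]addnC => /shift_inj.
  by move=> /(_ (ltn_ord _) (vn _ il) (vn _ jl)) /vinj; apply.
pose E (p : 'I_n * 'I_l) : {set complete_graph n} :=
  [set f p.1 p.2; f p.1 (p.2.+1 %% l)].
have succ_neq i : i < l -> i != i.+1 %% l.
  move=> il; apply/eqP; have [?|?] := leqP l i.+1.
    by have -> : i.+1 = l by [lia]; rewrite modnn; lia.
  by rewrite modn_small //; lia.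
have fneq (t : 'I_n) (i : 'I_l) : f t i != f t (i.+1 %% l).
  apply: contraNN (succ_neq _ (ltn_ord i)) => /eqP /finj /eqP; apply.
    by rewrite inE.
  by rewrite inE ltn_pmod.
(* Equal edges have the same circular length, which determines the index [i]. The translation is
   then read off an endpoint, the reversed matching being excluded by [shift_swap]. *)
have Einj : injective E.
  move=> [t i] [t' i'] /eq_set2 /= H.
  have ii' : i = i'.
    apply/val_inj/dinj; rewrite ?inE //=; case: H => [] [/wE e1 /wE e2].
      by apply: eq_circ_dist e1 e2; rewrite ?vn' ?vn.
    rewrite [X in _ = X]circ_distC.
    by apply: eq_circ_dist e1 e2; rewrite ?vn' ?vn.
  subst i'; congr (_, _); apply: val_inj.
  case: H => [] [/wE e1 /wE e2] /=; first by apply: shift_inj e1; rewrite ?vn.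
  have /vinj := shift_swap on (vn _ (ltn_ord i)) (vn' i) (ltn_ord t) (ltn_ord t') e1 e2.
  rewrite !inE ltn_ord ltn_pmod // => /(_ isT isT) /eqP.
  by rewrite (negPf (succ_neq _ (ltn_ord i))).
have cardn : #|complete_graph n| = n by rewrite card_ord.
have EE : edge_set (complete_graph n) = [set E p | p : 'I_n * 'I_l].
  (* One inclusion suffices: by injectivity of [E] there are n * l translated edges, and n * l is
     the binomial coefficient of n over 2. *)
  apply/esym/eqP; rewrite eqEcard; apply/andP; split.
    apply/subsetP=> _ /imsetP[[t i] _ ->]; apply/imsetP.
    by exists (f t i, f t (i.+1 %% l)); rewrite // inE; apply: fneq.
  rewrite (card_imset _ Einj) card_prod !card_ord.
  apply: (@leq_trans #|[set A : {set complete_graph n} | #|A| == 2]|).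
    apply/subset_leq_card/subsetP => _ /imsetP[[x y]] xy ->.
    by rewrite inE cards2 /=; have -> : x != y by move: xy; rewrite inE.
  have n1 : n.-1 = l.*2 by rewrite /n; lia.
  by rewrite card_draws cardn bin2 n1 -doubleMr doubleK.
pose C t := cycle_edges (mkseq (f t) l).
have uf t : uniq (mkseq (f t) l) by apply/mkseq_uniqP/finj.
have CE t : C t = [set E (t, i) | i : 'I_l] by rewrite /C cycle_edges_mkseq.
have Ccover t : cover (C t) = [set x in mkseq (f t) l].
  apply/setP=> x; rewrite inE CE; apply/bigcupP/mapP => [[_ /imsetP[i _ ->]]|[i]].
    rewrite !inE => /orP[] /eqP ->; [exists (val i) | exists (i.+1 %% l)] => //;
    by rewrite mem_iota //= ltn_pmod.
  rewrite mem_iota => /= il ->; exists (E (t, Ordinal il)); first exact: imset_f.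
  by rewrite !inE eqxx.
pose c (x : complete_graph n) := odd (x : 'I_n).
exists [set C t | t : 'I_n], c; split.
- split=> [_ /imsetP[t _ ->]|].
    split=> //; exists (mkseq (f t) l); split; rewrite ?size_mkseq //.
    rewrite /ucycle uf andbT; apply: (cycle_from_next (uf t)) => x /mapP[i].
    rewrite mem_iota => /= il ->{x}; rewrite next_mkseq //.
    exact: (fneq t (Ordinal il)).
  apply/and3P; split.
  - rewrite EE; apply/eqP/setP=> e; apply/bigcupP/imsetP.
      move=> [_ /imsetP[t _ ->]]; rewrite CE => /imsetP[i _ ->].
      by exists (t, i).
    move=> [[t i] _ ->]; exists (C t); first exact: imset_f.
    by rewrite CE; apply: imset_f.
  - apply/trivIsetP => _ _ /imsetP[t _ ->] /imsetP[t' _ ->] CC.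
    apply/pred0P => e /=; apply: contraNF CC => /andP[].
    rewrite {1}[C t]CE {1}[C t']CE => /imsetP[i _ ->] /imsetP[i' _ /Einj[-> _]].
    by [].
  - apply/imsetP => -[t _ C0].
    have : E (t, Ordinal l0) \in C t by rewrite CE; apply: imset_f.
    by rewrite -C0 inE.
- move=> _ /imsetP[t _ ->] b.
  pose g j := w (u j + t).
  (* Since [u] increases, exactly the vertices from index [J] on wrap around; [J] is [l] when none
     does. *)
  pose J := find (fun j => n <= u j + t) (iota 0 l).
  have Jl : J <= l by rewrite -[X in _ <= X](size_iota 0); apply: find_size.
  have oddg j : j < l -> odd (g j) = odd t (+) odd (if j < J then j else j.+1).
    move=> jl /=; rewrite modnD_lt ?un //; case: (ltnP j J) => [jJ|Jj].
      have := before_find 0 jJ; rewrite nth_iota //= => h.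
      by rewrite ltnNge h /= oddD uodd // addbC.
    have JL : J < l by lia.
    have : has (fun j => n <= u j + t) (iota 0 l) by rewrite has_find size_iota.
    move=> /(nth_find 0); rewrite -/J nth_iota //= => h.
    have h' : n <= u j + t.
      apply: leq_trans h _; rewrite leq_add2r; have [->//|jJ] := eqVneq j J.
      by rewrite ltnW // umono // ltn_neqAle eq_sym jJ Jj.
    rewrite ltnNge h' /= oddB // oddD uodd // on.
    by case: (odd j); case: (odd t).
  have ug : uniq (mkseq g l).
    apply/mkseq_uniqP => i j; rewrite !inE => il jl /wE.
    rewrite ![_ + t]addnC => /shift_inj.
    move=> /(_ (ltn_ord _) (un _ il) (un _ jl)).
    have := @umono i j; have := @umono j i; lia.
  (* Both lists are duplicate-free of length [l], so an inclusion makes them permutations of each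
     other. *)
  have fg : perm_eq (mkseq (f t) l) (mkseq g l).
    have sub : {subset mkseq (f t) l <= mkseq g l}.
      move=> x /mapP[i]; rewrite mem_iota => /= /vu[j jl vj] ->{x}.
      by apply/mapP; exists j; rewrite ?mem_iota // /f vj.
    apply: uniq_perm => //.
    by apply: (uniq_min_size (uf t) sub _).2; rewrite !size_mkseq.
  have -> : #|cover (C t) :&: colour_class c b| =
      count (fun j => odd (if j < J then j else j.+1) == odd t (+) b) (iota 0 l).
    rewrite Ccover.
    pose P x := c x == b.
    transitivity (count P (mkseq (f t) l)).
      rewrite -size_filter -(card_uniqP (filter_uniq P (uf t))).
      by apply: eq_card => x; rewrite !inE mem_filter andbC.
    rewrite (permP fg) count_map; apply: eq_in_count => j.
    rewrite mem_iota => /= jl; rewrite /P /c oddg //.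
    by rewrite -[RHS](inj_eq (@addbI (odd t))) addbA addbb.
  exact: count_odd_shifted.
- exists true.
  have cl b : #|colour_class c b| = count (fun j => odd j == b) (iota 0 n).
    rewrite cardE /enum_mem size_filter -val_enum_ord count_map enumT.
    by apply: eq_count => x /=; rewrite inE.
  by rewrite !cl !count_odd_iota /n /=; lia.
Qed.

(* For l = 4k+3: translate by k+2 of the closed walk from 0 with steps
   2k, -(2k-1), ..., -3, 2; -(2k+3), 2k+2, -(2k+1); 4k+3, -(4k+2), ..., -(2k+4); 1.
   Its vertices are 0, ..., 4k+4 except 3k+3 and 3k+4. *)
Definition base3 k i :=
  if odd i then
    if i < 2 * k then 3 * k + 2 - i./2
    else if i == 2 * k + 1 then 2 * k + 2 else 5 * k + 5 - i./2
  else if i < 2 * k then k + 2 + i./2 else i./2 - k.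

(** The blocks run through 2k, ..., 2, then 2k+3, 2k+2, 2k+1, then 4k+3, ..., 2k+4, then 1: each
    length once. *)
Definition dist3 k i :=
  if i < (2 * k).-1 then 2 * k - i
  else if i < 2 * k + 2 then 4 * k + 2 - i
  else if i < 4 * k + 2 then 6 * k + 5 - i else 1.

(* For l = 4k+1: closed walk mod n from 0, winding once around, with steps
   2k+3, -(2k+2), ..., 3, -2; 4k+1, -4k, 4k-1; 2k+4, -(2k+5), ..., 4k-2; 1.
   The third block needs k >= 3, so that l = 9 is a separate case. *)
Definition base1 k i :=
  if odd i then if i <= 2 * k + 1 then 2 * k + 3 - i./2 else 6 * k + 3 - i./2
  else if i <= 2 * k + 4 then i./2 else 6 * k + 2 + i./2.

Definition dist1 k i :=
  if i <= 2 * k + 1 then 2 * k + 3 - i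
  else if i <= 2 * k + 4 then 6 * k + 3 - i
  else if i < 4 * k then i.-1 else 1.

(** The alternatives say that y - x is d or -d modulo n, with or without wrapping; [2 * d <= n]
    makes d the shorter arc. *)
Lemma circ_distE n x y d : 2 * d <= n -> x < n -> y < n ->
  [\/ y = x + d, x = y + d, y + n = x + d | x + n = y + d] ->
  circ_dist n x y = d.
Proof. rewrite /circ_dist; move=> ? ? ? []; lia. Qed.

Lemma base3_range k i : i < 4 * k + 3 ->
  base3 k i < 3 * k + 3 \/ 3 * k + 5 <= base3 k i < 4 * k + 5.
Proof. by rewrite /base3 => hi; do !case: ifPn => ?; lia. Qed.

(** The two gaps omit 2k and 2k+2 residues. Both numbers are even, so the increasing enumeration of
    the vertices still alternates in parity. *)
Lemma base1_range k i : i < 4 * k + 1 ->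
  base1 k i < 2 * k + 4 \/
  4 * k + 4 <= base1 k i < 5 * k + 3 \/ 7 * k + 5 <= base1 k i < 8 * k + 3.
Proof. by rewrite /base1 => hi; do !case: ifPn => ?; lia. Qed.

Lemma base3_lt k i : i < 4 * k + 3 -> base3 k i < 2 * (4 * k + 3) + 1.
Proof. rewrite /base3 => hi; do !case: ifPn => ?; lia. Qed.

Lemma base1_lt k i : i < 4 * k + 1 -> base1 k i < 2 * (4 * k + 1) + 1.
Proof. rewrite /base1 => hi; do !case: ifPn => ?; lia. Qed.

Lemma base3_inj k : {in gtn (4 * k + 3) &, injective (base3 k)}.
Proof.
move=> i j; rewrite !inE /base3 => hi hj; do !case: ifPn => ?; lia.
Qed.

Lemma base1_inj k : 2 < k -> {in gtn (4 * k + 1) &, injective (base1 k)}.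
Proof.
move=> hk i j; rewrite !inE /base1 => hi hj; do !case: ifPn => ?; lia.
Qed.

Lemma dist3_inj k : 0 < k -> {in gtn (4 * k + 3) &, injective (dist3 k)}.
Proof.
move=> hk i j; rewrite !inE /dist3 => hi hj; do !case: ifPn => ?; lia.
Qed.

Lemma dist1_inj k : 2 < k -> {in gtn (4 * k + 1) &, injective (dist1 k)}.
Proof.
move=> hk i j; rewrite !inE /dist1 => hi hj; do !case: ifPn => ?; lia.
Qed.

Lemma succ_modn i l : i < l -> i.+1 %% l = if i.+1 == l then 0 else i.+1.
Proof.
by move=> il; case: eqVneq => [->|ne]; [rewrite modnn | rewrite modn_small //; lia].
Qed.

Lemma circ_dist_base3 k i : 0 < k -> i < 4 * k + 3 ->
  circ_dist (2 * (4 * k + 3) + 1) (base3 k i) (base3 k (i.+1 %% (4 * k + 3))) =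
  dist3 k i.
Proof.
move=> hk hi; apply: circ_distE.
- by rewrite /dist3; do !case: ifPn => ?; lia.
- exact: base3_lt.
- by apply: base3_lt; rewrite ltn_pmod //; lia.
rewrite succ_modn //; case: eqP => hl.
  by apply: Or41; rewrite /base3 /dist3; do !case: ifPn => ?; lia.
have [oi|ei] := boolP (odd i).
  by apply: Or42; rewrite /base3 /dist3 /= oi; do !case: ifPn => ?; lia.
by apply: Or41; rewrite /base3 /dist3 /= ei (negPf ei); do !case: ifPn => ?; lia.
Qed.

Lemma circ_dist_base1 k i : 2 < k -> i < 4 * k + 1 ->
  circ_dist (2 * (4 * k + 1) + 1) (base1 k i) (base1 k (i.+1 %% (4 * k + 1))) =
  dist1 k i.
Proof.
move=> hk hi; apply: circ_distE.
- by rewrite /dist1; do !case: ifPn => ?; lia.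
- exact: base1_lt.
- by apply: base1_lt; rewrite ltn_pmod //; lia.
rewrite succ_modn //; case: eqP => hl.
  (* The closing step, from 8k+2 to 0, is the only one that wraps around. *)
  by apply: Or43; rewrite /base1 /dist1 /=; do !case: ifPn => ?; lia.
(* Steps alternate in sign, except that those at 2k+4 and 2k+5 both go up, which exchanges the roles
   of odd and even indices afterwards. *)
have [oi|ei] := boolP (odd i); have [lei|lti] := leqP i (2 * k + 4).
- by apply: Or42; rewrite /base1 /dist1 /= oi; do !case: ifPn => ?; lia.
- by apply: Or41; rewrite /base1 /dist1 /= oi; do !case: ifPn => ?; lia.
- by apply: Or41; rewrite /base1 /dist1 /= ei (negPf ei); do !case: ifPn => ?; lia.
- by apply: Or42; rewrite /base1 /dist1 /= ei (negPf ei); do !case: ifPn => ?; lia.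
Qed.

Theorem theorem4 (l : nat) (hl : 7 <= l) (odd_l : odd l) :
  exists (D : {set {set {set complete_graph (2 * l + 1)}}})
         (c : complete_graph (2 * l + 1) -> bool),
    [/\ cycle_decomposition l D,
        equitable l D c
      & exists b : bool,
          #|colour_class c b| = l /\ #|colour_class c (~~ b)| = l + 1].
Proof.
have l3 : 2 < l by lia.
have [l_mod|[l9|l_mod]] : l = 4 * (l %/ 4) + 3 \/ l = 9 \/
    l = 4 * (l %/ 4) + 1 /\ 2 < l %/ 4.
  by lia.
- move: (l %/ 4) l_mod => k l_mod; subst l; have k0 : 0 < k by lia.
  apply: (@cyclic_decomposition _ (base3 k)
    (fun j => if j < 3 * k + 3 then j else j + 2)) => //.
  + exact: base3_lt.
  + exact: base3_inj.
  + by move=> i j hi hj; rewrite !circ_dist_base3 //; apply: dist3_inj.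
  + move=> i /base3_range[b_lt|b_ge]; [exists (base3 k i) | exists (base3 k i - 2)];
      by rewrite /=; do ?case: ifPn => ?; lia.
  + by move=> j hj /=; case: ifPn => ?; lia.
  + by move=> i j hj /=; do !case: ifPn => ?; lia.
  + by move=> j hj /=; case: ifPn => ?; lia.
(* Modulo 19 the successive circular lengths are 1, 2, 3, 5, 4, 8, 7, 6, 9. *)
- subst l; pose v := nth 0 [:: 0; 1; 18; 2; 7; 3; 11; 4; 10].
  apply: (@cyclic_decomposition _ v (nth 0 [:: 0; 1; 2; 3; 4; 7; 10; 11; 18])) => //.
  + by do 9?case=> //.
  + exact/(mkseq_uniqP v 9).
  + exact/mkseq_uniqP.
  + move=> i hi; exists (index (v i) [:: 0; 1; 2; 3; 4; 7; 10; 11; 18]).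
      by move: i hi; do 9?case=> //.
    by move: i hi; do 9?case=> //.
  + by do 9?case=> //.
  + move=> i j /andP[ij hj].
    by apply: (sorted_ltn_nth ltn_trans) => //; rewrite inE //= (ltn_trans ij).
  + by do 9?case=> //.
- case: l_mod; move: (l %/ 4) => k l_mod k2; subst l.
  apply: (@cyclic_decomposition _ (base1 k)
    (fun j => if j < 2 * k + 4 then j else
       if j < 3 * k + 3 then j + 2 * k else j + 4 * k + 2)) => //.
  + exact: base1_lt.
  + exact: base1_inj.
  + by move=> i j hi hj; rewrite !circ_dist_base1 //; apply: dist1_inj.
  + move=> i /base1_range[b_lt|[b_mid|b_ge]]; [exists (base1 k i)
      | exists (base1 k i - 2 * k) | exists (base1 k i - (4 * k + 2))];
      by rewrite /=; do ?case: ifPn => ?; lia.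
  + by move=> j hj /=; do !case: ifPn => ?; lia.
  + by move=> i j hj /=; do !case: ifPn => ?; lia.
  + by move=> j hj /=; do !case: ifPn => ?; lia.
Qed.
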